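(* Let $\nu$ be a finite positive measure on $(1/2,\infty)$, and let $$\alpha(n)=\int_{1/2}^\infty n^{-s}\,d\nu(s),\qquad n\ge1.$$ Then the following are equivalent: (1) $M(\alpha)$ is a bounded operator on $\ell^2(\mathbb{N})$. (2) There is $C>0$ such that $\nu((1/2,s])\le C(s-1/2)$ as $s\to1/2$ (i.e. for all $s>1/2$ sufficiently close to $1/2$). (3) There is $C>0$ such that $\alpha(n)\le\dfrac{C}{\sqrt n\,\log n}$ for all $n\ge2$. (4) The Hankel type integral operator $$G:L^2(\nu)\to L^2(\nu),\qquad (Gf)(t)=\int_{1/2}^\infty\zeta(s+t)f(s)\,d\nu(s),\quad t>1/2,$$ is bounded on $L^2(\nu)$, where $\zeta(t)=\sum_{n=1}^\infty n^{-t}$ is the Riemann zeta function.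
   Context: $\mathbb{N}=\{1,2,\dots\}$. For a sequence $\alpha=\{\alpha(n)\}_{n=1}^\infty$, $M(\alpha)$ is the Helson matrix $\{\alpha(nm)\}_{n,m=1}^\infty$, viewed as a (potentially unbounded) operator on $\ell^2(\mathbb{N})$; it is bounded if there is $C$ with $|\sum_{n,m\ge1}\alpha(nm)f_n\overline{g_m}|\le C\|f\|_{\ell^2}\|g\|_{\ell^2}$ for all finitely supported sequences $f,g$. *)

(* Defs.v *)
From HB Require Import structures.
From mathcomp Require Export all_boot all_order all_algebra.
From mathcomp Require Export all_classical all_reals all_analysis.
From mathcomp.real_closed Require Export complex.

Set Implicit Arguments.
Unset Strict Implicit.
Unset Printing Implicit Defensive.

Import Order.TTheory GRing.Theory Num.Theory.
Import numFieldNormedType.Exports.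

Local Open Scope classical_set_scope.
Local Open Scope ring_scope.
Local Open Scope complex_scope.

Definition modulus (R : realType) (z : R[i]) : R := ComplexField.Normc.normc z.

(* Sequences are indexed by {1, 2, ...}: they are functions on nat whose value
   at 0 is never used. *)
Definition posnat : set nat := [set n | (0 < n)%N].

Definition finitely_supported (R : realType) (f : nat -> R[i]) : Prop :=
  finite_set [set n | posnat n /\ f n != 0].

(* [\sum_(n \in posnat)] is the sum over the finite support in [posnat], so
   this is the l^2 norm for finitely supported sequences only. *)
Definition fin_l2norm (R : realType) (f : nat -> R[i]) : R :=
  Num.sqrt (\sum_(n \in posnat) modulus (f n) ^+ 2).

Definition helson_matrix (R : realType) (alpha : nat -> R[i]) (n m : nat) : R[i] :=
  alpha (n * m)%N.

Definition l2_bounded_matrix (R : realType) (M : nat -> nat -> R[i]) : Prop :=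
  exists C : R, forall f g : nat -> R[i],
    finitely_supported f -> finitely_supported g ->
    modulus (\sum_(n \in posnat) \sum_(m \in posnat) M n m * f n * (g m)^*)
      <= C * fin_l2norm f * fin_l2norm g.

Definition half_line (R : realType) : set (measurableTypeR R) := `]2^-1, +oo[.
Arguments half_line : clear implicits.

Definition dirichlet_moment (R : realType)
    (nu : {finite_measure set (measurableTypeR R) -> \bar R}) (n : nat) : R :=
  Rintegral nu (half_line R) (fun s => n%:R `^ (- s)).

(* Only used for real t > 1, where the series converges. *)
Definition zeta (R : realType) (t : R) : R :=
  limn (fun N => \sum_(1 <= n < N) n%:R `^ (- t)).

Definition cintegral (R : realType)
    (nu : {finite_measure set (measurableTypeR R) -> \bar R})
    (f : measurableTypeR R -> R[i]) : R[i] :=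
  Rintegral nu (half_line R) (fun s => complex.Re (f s)) +i*
  Rintegral nu (half_line R) (fun s => complex.Im (f s)).

(* Measurable representatives of the elements of the complex space L^2(nu):
   [L2norm] and [zeta_operator] below depend only on the class of f modulo
   nu-a.e. equality on the half-line. *)
Definition in_L2 (R : realType)
    (nu : {finite_measure set (measurableTypeR R) -> \bar R})
    (f : measurableTypeR R -> R[i]) : Prop :=
  [/\ measurable_fun (half_line R) (fun s => complex.Re (f s)),
      measurable_fun (half_line R) (fun s => complex.Im (f s)) &
      (\int[nu]_(s in half_line R) ((modulus (f s) ^+ 2)%:E) < +oo)%E].

Definition L2norm (R : realType)
    (nu : {finite_measure set (measurableTypeR R) -> \bar R})
    (f : measurableTypeR R -> R[i]) : R :=
  Num.sqrt (Rintegral nu (half_line R) (fun s => modulus (f s) ^+ 2)).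

Definition L2_bounded_operator (R : realType)
    (nu : {finite_measure set (measurableTypeR R) -> \bar R})
    (T : (measurableTypeR R -> R[i]) -> measurableTypeR R -> R[i]) : Prop :=
  exists C : R, forall f, in_L2 nu f ->
    in_L2 nu (T f) /\ L2norm nu (T f) <= C * L2norm nu f.

(* The integrand is nu-integrable for every f in L^2(nu) and every t > 1/2,
   since nu is finite and zeta (s + t) <= zeta (1/2 + t) for s > 1/2. *)
Definition zeta_operator (R : realType)
    (nu : {finite_measure set (measurableTypeR R) -> \bar R})
    (f : measurableTypeR R -> R[i]) (t : measurableTypeR R) : R[i] :=
  cintegral nu (fun s => (zeta (s + t))%:C * f s).

(* Main.v *)
Require Import Defs.
From mathcomp Require Import measurable_realfun ring lra.
Import Order.TTheory GRing.Theory Num.Theory.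
Import numFieldNormedType.Exports.

(** Write [s = 1/2 + x].  Up to the harmless factor [n ^ (- 1/2)], the moments
    [alpha n] form the Laplace transform of [nu] at [ln n], so that linear mass
    near [1/2] and the decay [alpha n <= C / (sqrt n * ln n)] are two readings
    of one condition.  The other two conditions are tied to it as follows.

    From boundedness to linear mass, one tests on a single function.  For
    [e > 0] put [N = floor (exp (1 / e)) + 1]; then [n ^ (- e) >= exp (- 1)] for
    [n < N], while [\sum_(n < N) 1 / n >= ln N >= 1 / e]
    ([harmonic_cutoff]).  With this cut-off, testing the matrix on
    [n ^ (- 1/2)], [n < N], gives [nu (1/2, 1/2 + e] <= C exp 2 * e]
    ([linear_mass_of_helson_bounded]); and since the cut-off also gives
    [zeta (1 + 2 * e) >= exp (- 2) / e], testing the integral operator on the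
    indicator of [(1/2, 1/2 + e]] gives the same bound
    ([linear_mass_of_zeta_bounded]).

    From linear mass to decay, [exp (- y)] is dominated by a dyadic combination
    of the indicators of [y <= k + 1], which is integrated term by term
    ([decay_of_linear_mass]).

    From decay to boundedness of the matrix, the entries are dominated by the
    multiplicative Hilbert matrix [1 / (sqrt (n * m) * (1 + ln (n * m)))], to
    which Schur's test applies with the weights [1 / sqrt (n * (1 + ln n))]
    ([helson_schur]); the row sums telescope because [1 / n] is at most the
    increment of the logarithm ([schur_row_sum]).

    Finally let [J] send [f] in [L^2(nu)] to the sequence of the integrals of
    [n ^ (- s) * f s].  Then [J J^*] is the matrix and [J^* J] is the zeta
    operator, because [\sum_n n ^ (- s) * n ^ (- t) = zeta (s + t)].  The bound
    on the matrix therefore passes to the operator; concretely, the bound is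
    proved for the Dirichlet polynomials [\sum_(n < N) (J f) n * n ^ (- t)] and
    transferred to their limit by Fatou's lemma ([zeta_real_bounded]). *)

Set Implicit Arguments.
Unset Strict Implicit.
Unset Printing Implicit Defensive.

Local Open Scope classical_set_scope.
Local Open Scope ring_scope.
Local Open Scope complex_scope.

(** * Harmonic sums and zeta near its pole *)

Lemma powRN_expR (R : realType) (n : nat) (s : R) : (0 < n)%N ->
  n%:R `^ (- s) = expR (- (s * ln n%:R)).
Proof. by move=> n0; rewrite /powR pnatr_eq0 gtn_eqF// mulNr. Qed.

Lemma invr_natS_le_lnB (R : realType) (n : nat) : (0 < n)%N ->
  n.+1%:R^-1 <= ln n.+1%:R - ln n%:R :> R.
Proof.
move=> n0; have n0R : 0 < n%:R :> R by rewrite ltr0n.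
have /le_ln1Dx : -1 < - n.+1%:R^-1 :> R.
  by rewrite ltrN2 invf_lt1 ?ltr0n// ltr1n.
have -> : 1 + - n.+1%:R^-1 = n%:R / n.+1%:R :> R.
  by rewrite -natr1; field; rewrite natr1 pnatr_eq0.
by rewrite ln_div ?posrE ?ltr0n// -[X in _ -> _ <= X]opprB lerNr.
Qed.

Lemma lnB_le_invr_nat (R : realType) (n : nat) : (0 < n)%N ->
  ln n.+1%:R - ln n%:R <= n%:R^-1 :> R.
Proof.
move=> n0; have n0R : 0 < n%:R :> R by rewrite ltr0n.
have /le_ln1Dx : -1 < n%:R^-1 :> R.
  by rewrite (lt_trans _ (_ : 0 < _)) ?invr_gt0// ltrN10.
have -> : 1 + n%:R^-1 = n.+1%:R / n%:R :> R.
  by rewrite -natr1; field; rewrite gt_eqF.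
by rewrite ln_div ?posrE ?ltr0n.
Qed.

Lemma ln_le_harmonic (R : realType) (N : nat) : (0 < N)%N ->
  ln N%:R <= \sum_(1 <= n < N) n%:R^-1 :> R.
Proof.
case: N => // N _; elim: N => [|N IH]; first by rewrite ln1 big_geq.
rewrite big_nat_recr//=; apply: le_trans (lerD IH (lnB_le_invr_nat R _)) => //.
by rewrite addrC subrK.
Qed.

(** The sum stops where [n ^ (- e)] has dropped by a constant factor, so that
    up to that factor a sum of [n ^ (- 1 - e)] is at least [1 / e]. *)
Lemma harmonic_cutoff (R : realType) (e : R) : 0 < e ->
  exists N : nat, [/\ (1 < N)%N,
    e^-1 <= \sum_(1 <= n < N) n%:R^-1 &
    forall n, (1 <= n < N)%N -> expR (-1) <= n%:R `^ (- e)].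
Proof.
move=> e0; exists (Num.trunc (expR e^-1)).+1; split.
- by rewrite ltnS truncn_gt0 -expR0 ler_expR invr_ge0 ltW.
- apply: le_trans (ln_le_harmonic R _) => //.
  by rewrite -[leLHS]expRK ler_ln ?posrE ?expR_gt0 ?ltr0n// ltW// truncnS_gt.
- move=> n /andP[n0]; rewrite ltnS truncn_ge_nat ?expR_ge0// => nN.
  rewrite powRN_expR// ler_expR lerN2 mulrC -ler_pdivlMr//.
  by rewrite -[leRHS]expRK ler_ln ?posrE ?expR_gt0 ?ltr0n// mul1r.
Qed.

(** The integral comparison for [\sum_n n ^ (- 1 - d)], in a telescoping form
    that follows from [1 + x <= exp x] alone. *)
Lemma powR_telescope (R : realType) (d : R) (n : nat) : 0 < d -> (0 < n)%N ->
  n.+1%:R `^ (- (1 + d)) <= d^-1 * (n%:R `^ (- d) - n.+1%:R `^ (- d)).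
Proof.
move=> d0 n0.
have -> : n.+1%:R `^ (- (1 + d)) = n.+1%:R^-1 * n.+1%:R `^ (- d).
  by rewrite opprD powRD ?pnatr_eq0 ?implybT// powR_inv1 ?ler0n.
have -> : n%:R `^ (- d) - n.+1%:R `^ (- d) =
    n.+1%:R `^ (- d) * (expR (d * (ln n.+1%:R - ln n%:R)) - 1).
  rewrite !powRN_expR// mulrBr -expRD mulr1; congr (expR _ - _); ring.
rewrite mulrA [d^-1 * _]mulrC -mulrA [leLHS]mulrC ler_wpM2l ?powR_ge0//.
rewrite mulrC ler_pdivlMr// mulrC.
apply: (@le_trans _ _ (d * (ln n.+1%:R - ln n%:R))).
  by rewrite ler_wpM2l ?invr_natS_le_lnB// ltW.
by rewrite lerBrDl expR_ge1Dx.
Qed.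

Lemma zeta_sum_le (R : realType) (d : R) (N : nat) : 0 < d ->
  \sum_(1 <= n < N) n%:R `^ (- (1 + d)) <= 1 + d^-1.
Proof.
move=> d0; case: N => [|[|N]]; try by rewrite big_geq// addr_ge0// invr_ge0 ltW.
suff : \sum_(1 <= n < N.+2) n%:R `^ (- (1 + d)) <=
    1 + d^-1 * (1 - N.+1%:R `^ (- d)).
  move/le_trans; apply; rewrite lerD2l ler_piMr ?invr_ge0 ?(ltW d0)//.
elim: N => [|N IH]; first by rewrite big_nat1 !powR1 subrr mulr0 addr0.
rewrite big_nat_recr//=; have := @powR_telescope R d N.+1 d0 isT; lra.
Qed.

Lemma zeta_sum_homo (R : realType) (t : R) :
  {homo (fun N => \sum_(1 <= n < N) n%:R `^ (- t)) : n m / (n <= m)%N >-> n <= m}.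
Proof.
apply/nondecreasing_seqP => N; case: N => [|N]; first by rewrite !big_geq.
by rewrite [leRHS]big_nat_recr//= lerDl powR_ge0.
Qed.

Lemma zeta_sum_cvg (R : realType) (t : R) : 1 < t ->
  \sum_(1 <= n < N) n%:R `^ (- t) @[N --> \oo] --> zeta t.
Proof.
move=> t1; apply: nondecreasing_is_cvgn; first exact: zeta_sum_homo.
exists (1 + (t - 1)^-1) => _ [N _ <-].
by rewrite -{1}[t](subrKC 1) zeta_sum_le// subr_gt0.
Qed.

Lemma zeta_sum_le_zeta (R : realType) (t : R) (N : nat) : 1 < t ->
  \sum_(1 <= n < N) n%:R `^ (- t) <= zeta t.
Proof.
move=> t1; apply: (nondecreasing_cvgn_le (@zeta_sum_homo R t)).
by apply/cvg_ex; eexists; exact: zeta_sum_cvg.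
Qed.

(** The pole of zeta at [1], seen from below.  The range up to [1 + 2 * e] covers
    [s + t] for [s] and [t] at most [1/2 + e]. *)
Lemma zeta_ge (R : realType) (e t : R) : 0 < e -> 1 < t <= 1 + 2 * e ->
  expR (-2) / e <= zeta t.
Proof.
move=> e0 /andP[t1 te]; have [N [N1 HN lN]] := harmonic_cutoff e0.
apply: le_trans (zeta_sum_le_zeta N t1).
apply: (@le_trans _ _ (expR (-2) * \sum_(1 <= n < N) n%:R^-1)).
  by rewrite ler_wpM2l ?expR_ge0.
rewrite mulr_sumr; apply: ler_sum_nat => n nN; have /andP[n0 _] := nN.
have n1 : 1 <= n%:R :> R by rewrite ler1n.
apply: (@le_trans _ _ (n%:R `^ (- (1 + 2 * e)))); last by rewrite ler_powR// lerN2.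
rewrite (opprD 1 (2 * e)) powRD ?pnatr_eq0 ?gtn_eqF ?implybT// powR_inv1 ?ler0n//.
rewrite mulrC ler_wpM2l ?invr_ge0 ?ler0n//.
have -> : - (2 * e) = - e + - e by ring.
rewrite powRD ?pnatr_eq0 ?gtn_eqF ?implybT//.
have -> : -2 = -1 + -1 :> R by ring.
by rewrite expRD ler_pM ?expR_ge0 ?lN.
Qed.

(** * Schur's test for the multiplicative Hilbert matrix *)

(** The shift by [1] makes the weight usable at [n = 1], where [ln] vanishes. *)
Definition log1 (R : realType) (n : nat) : R := 1 + ln n%:R.

Lemma log1_ge1 (R : realType) (n : nat) : (0 < n)%N -> 1 <= log1 R n.
Proof. by move=> n0; rewrite lerDl ln_ge0// ler1n. Qed.

Lemma ler_log1 (R : realType) (m n : nat) : (0 < m <= n)%N ->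
  log1 R m <= log1 R n.
Proof.
move=> /andP[m0 mn]; rewrite lerD2l ler_ln ?posrE ?ltr0n// ?ler_nat//.
exact: leq_trans mn.
Qed.

(** The two telescoping inequalities behind the row sums: if [d] is at most an
    increment of [w = x ^ 2], then [d / sqrt w] is at most an increment of
    [2 * sqrt w] and [d / w ^ (3/2)] an increment of [- 2 / sqrt w]. *)
Lemma sqrt_increment (R : realType) (d x y : R) : 0 < y <= x -> 0 <= d <= x ^+ 2 - y ^+ 2 ->
  d / x <= 2 * (x - y) /\ d / (x ^+ 2 * x) <= 2 * (y^-1 - x^-1).
Proof.
move=> /andP[y0 yx] /andP[d0 dxy].
have x0 : 0 < x by exact: lt_le_trans yx.
split; first by rewrite ler_pdivrMr//; nra.
have -> : 2 * (y^-1 - x^-1) = 2 * (x - y) * x / (x * y) * x^-1 by field; rewrite !gt_eqF.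
rewrite invfM mulrA ler_wpM2r ?invr_ge0 ?(ltW x0)//.
rewrite ler_pdivrMr ?exprn_gt0// mulrAC ler_pdivlMr ?mulr_gt0//.
suff : d * y <= 2 * (x - y) * x * x by move=> h; rewrite expr2; nra.
have h1 : d <= 2 * (x - y) * x by nra.
apply: ler_pM => //; exact: ltW.
Qed.

(** Below [n] the maximum is constant and the terms add up like [1 / sqrt w];
    above [n] they add up like [w ^ (- 3/2)].  Both sums telescope by
    [sqrt_increment], and both contribute a multiple of [1 / sqrt (log1 n)]. *)
Lemma schur_row_sum (R : realType) (n N : nat) : (0 < n)%N ->
  \sum_(1 <= m < N) (m%:R * Num.max (log1 R n) (log1 R m) * Num.sqrt (log1 R m))^-1
    <= 4 / Num.sqrt (log1 R n).
Proof.
move=> n0; pose r (m : nat) : R := Num.sqrt (log1 R m); rewrite -/(r n).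
have l0 m : (0 < m)%N -> 0 < log1 R m by move=> m0; rewrite (lt_le_trans ltr01)// log1_ge1.
have r0 m : (0 < m)%N -> 0 < r m by move=> m0; rewrite sqrtr_gt0 l0.
have r1 m : (0 < m)%N -> 1 <= r m by move=> m0; rewrite -sqrtr1 ler_wsqrtr ?log1_ge1.
have rE m : (0 < m)%N -> log1 R m = r m ^+ 2 by move=> m0; rewrite sqr_sqrtr// ltW// l0.
have rle m k : (0 < m <= k)%N -> r m <= r k.
  by move=> mk; rewrite ler_wsqrtr ?ler_log1.
set z := r n; have z0 : 0 < z by exact: r0.
case: N => [|[|N]]; try by rewrite big_geq// divr_ge0// ltW.
(* [Phi] is the potential: each term is at most its increment, across [m = n] too. *)
pose Phi m := if (m <= n)%N then 2 * r m / z ^+ 2 else 4 / z - 2 / r m.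
suff H : \sum_(1 <= m < N.+2)
    (m%:R * Num.max (log1 R n) (log1 R m) * Num.sqrt (log1 R m))^-1 <= Phi N.+1.
  apply: le_trans H _; rewrite /Phi; case: ifPn => Nn; last first.
    by rewrite gerBl divr_ge0// ltW// r0.
  rewrite expr2 invfM mulrA ler_wpM2r ?invr_ge0 ?(ltW z0)// ler_pdivrMr//.
  by have := rle N.+1 n Nn; rewrite -/z => h; lra.
elim: N => [|N IH].
  rewrite big_nat1 /Phi n0 mul1r -!/(r _) (max_idPl _); last exact: ler_log1.
  rewrite rE// -/z.
  rewrite invfM mulrC ler_wpM2r ?invr_ge0 ?sqr_ge0//.
  have h : (r 1%N)^-1 <= 1 by rewrite invf_le1 ?r0 ?r1.
  by have := r1 1%N isT; lra.
rewrite big_nat_recr//=; apply: (le_trans (lerD IH (lexx _))); rewrite -lerBrDl.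
set d := (N.+2%:R : R)^-1.
have dr : 0 <= d <= r N.+2 ^+ 2 - r N.+1 ^+ 2.
  rewrite invr_ge0 ler0n/= -!rE// /log1.
  by have := @invr_natS_le_lnB R N.+1 isT; rewrite -/d; lra.
have [|A B] := @sqrt_increment R d (r N.+2) (r N.+1) _ dr.
  by rewrite r0//= rle//= leqnSn.
rewrite !invfM -/d -/(r _) /Phi; case: (leqP N.+2 n) => Nn.
- rewrite (ltnW Nn) max_l ?ler_log1// (rE n)// -/z.
  by rewrite mulrAC -mulrBl -mulrBr ler_wpM2r ?invr_ge0 ?sqr_ge0.
- rewrite max_r; last by rewrite ler_log1// n0 ltnW.
  rewrite rE// -[d * _ * _]mulrA -invfM.
  apply: (le_trans B).
  case: (leqP N.+1 n) => Nn2.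
  + have -> : z = r N.+1.
      by congr r; apply/eqP; rewrite eqn_leq Nn2 -ltnS Nn.
    have y0 : r N.+1 != 0 by rewrite gt_eqF// r0.
    have -> : 2 * r N.+1 / r N.+1 ^+ 2 = 2 * (r N.+1)^-1 by field.
    by move: (r N.+1)^-1 (r N.+2)^-1 => a b; lra.
  + by move: (r N.+1)^-1 (r N.+2)^-1 z^-1 => a b c; lra.
Qed.

Lemma young_mul (R : realFieldType) (t u v : R) : 0 < t ->
  u * v <= 2^-1 * (t * u ^+ 2 + t^-1 * v ^+ 2).
Proof.
move=> t0; have : 0 <= t^-1 * (t * u - v) ^+ 2.
  by rewrite mulr_ge0 ?sqr_ge0 ?invr_ge0 ?ltW.
have -> : t^-1 * (t * u - v) ^+ 2 = t * u ^+ 2 - 2 * (u * v) + t^-1 * v ^+ 2.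
  by field; rewrite gt_eqF.
by move: (t^-1 * _) => a h; lra.
Qed.

(** Each product is split by [young_mul] with [t = p m / p n]; summing over the
    free index then leaves exactly the weighted row sums. *)
Lemma schur_test (R : realFieldType) (B : R) (N : nat) (K : nat -> nat -> R)
    (p u v : nat -> R) :
  (forall n m, (0 < n)%N -> (0 < m)%N -> 0 <= K n m) ->
  (forall n m, K n m = K m n) ->
  (forall n, (0 < n)%N -> 0 < p n) ->
  (forall n, (0 < n)%N -> \sum_(1 <= m < N) K n m * p m <= B * p n) ->
  \sum_(1 <= n < N) \sum_(1 <= m < N) K n m * (u n * v m) <=
    2^-1 * (B * (\sum_(1 <= n < N) u n ^+ 2) + B * (\sum_(1 <= n < N) v n ^+ 2)).
Proof.
move=> K0 Ksym p0 Kp.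
have half w : \sum_(1 <= n < N) \sum_(1 <= m < N) K n m * (p m / p n * w n ^+ 2)
    <= B * \sum_(1 <= n < N) w n ^+ 2.
  rewrite mulr_sumr; apply: ler_sum_nat => n /andP[n0 _].
  have -> : \sum_(1 <= m < N) K n m * (p m / p n * w n ^+ 2) =
      (\sum_(1 <= m < N) K n m * p m) * ((p n)^-1 * w n ^+ 2).
    by rewrite mulr_suml; apply: eq_bigr => m _; ring.
  have -> : B * w n ^+ 2 = B * p n * ((p n)^-1 * w n ^+ 2).
    by field; rewrite gt_eqF// p0.
  by rewrite ler_wpM2r ?Kp// mulr_ge0 ?sqr_ge0// invr_ge0 ltW// p0.
apply: le_trans (ler_wpM2l _ (lerD (half u) (half v))); last by rewrite invr_ge0.
rewrite [X in _ <= _ * (_ + X)]exchange_big/= -big_split/= mulr_sumr.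
apply: ler_sum_nat => n /andP[n0 _]; rewrite -big_split/= mulr_sumr.
apply: ler_sum_nat => m /andP[m0 _]; rewrite (Ksym m n) -mulrDr [leRHS]mulrCA.
rewrite ler_wpM2l ?K0//.
have := @young_mul R (p m / p n) (u n) (v m); rewrite invf_div; apply.
by rewrite divr_gt0 ?p0.
Qed.

(** Since [log1 (n * m)] dominates both [log1 n] and [log1 m], the kernel is at
    most [A / (sqrt n * sqrt m * max (log1 n) (log1 m))], whose weighted row sums
    are those of [schur_row_sum]. *)
Lemma helson_schur (R : realType) (A : R) (a : nat -> R) (u v : nat -> R) (N : nat) :
  0 <= A ->
  (forall n, (0 < n)%N -> 0 <= a n <= A / (Num.sqrt n%:R * log1 R n)) ->
  \sum_(1 <= n < N) \sum_(1 <= m < N) a (n * m)%N * (u n * v m) <=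
    2 * A * (\sum_(1 <= n < N) u n ^+ 2 + \sum_(1 <= n < N) v n ^+ 2).
Proof.
move=> A0 aA.
pose p n : R := (Num.sqrt n%:R * Num.sqrt (log1 R n))^-1.
have l0 m : (0 < m)%N -> 0 < log1 R m.
  by move=> m0; rewrite (lt_le_trans ltr01)// log1_ge1.
have s0 m : (0 < m)%N -> 0 < Num.sqrt m%:R :> R by move=> m0; rewrite sqrtr_gt0 ltr0n.
have := @schur_test R (4 * A) N (fun n m => a (n * m)%N) p u v.
have -> (x y : R) : 2^-1 * (4 * A * x + 4 * A * y) = 2 * A * (x + y) by field.
apply.
- move=> n m n0 m0; have nm0 : (0 < n * m)%N by rewrite muln_gt0 n0.
  by case/andP: (aA _ nm0).
- by move=> n m; rewrite mulnC.
- by move=> n n0; rewrite invr_gt0 mulr_gt0 ?s0// sqrtr_gt0 l0.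
move=> n n0; apply: (@le_trans _ _ (A / Num.sqrt n%:R * \sum_(1 <= m < N)
   (m%:R * Num.max (log1 R n) (log1 R m) * Num.sqrt (log1 R m))^-1)).
  rewrite mulr_sumr; apply: ler_sum_nat => m /andP[m0 _].
  have nm0 : (0 < n * m)%N by rewrite muln_gt0 n0.
  have /andP[_ h] := aA _ nm0.
  apply: (le_trans (ler_wpM2r _ h)).
    by rewrite invr_ge0 mulr_ge0 ?sqrtr_ge0.
  have mx : Num.max (log1 R n) (log1 R m) <= log1 R (n * m)%N.
    by rewrite ge_max !ler_log1 ?n0 ?m0 ?leq_pmulr ?leq_pmull.
  have mx0 : 0 < Num.max (log1 R n) (log1 R m) by rewrite lt_max l0.
  rewrite natrM sqrtrM ?ler0n// -[leLHS]mulrA -[leRHS]mulrA ler_wpM2l// -!invfM.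
  have r0 : 0 < Num.sqrt (log1 R m) by rewrite sqrtr_gt0 l0.
  rewrite lef_pV2 ?posrE ?mulr_gt0 ?s0 ?l0 ?ltr0n//.
  rewrite -{1}[m%:R]sqr_sqrtr ?ler0n// expr2.
  move: (s0 _ n0) (s0 _ m0) => sn sm.
  have -> : Num.sqrt n%:R * Num.sqrt m%:R * log1 R (n * m) *
      (Num.sqrt m%:R * Num.sqrt (log1 R m)) = Num.sqrt n%:R *
      (Num.sqrt m%:R * Num.sqrt m%:R * log1 R (n * m) * Num.sqrt (log1 R m)) by ring.
  by rewrite ler_wpM2l ?(ltW sn)// ler_wpM2r ?(ltW r0)// ler_wpM2l// mulr_ge0 ?ltW.
apply: (le_trans (ler_wpM2l _ (schur_row_sum R N n0))).
  by rewrite divr_ge0 ?sqrtr_ge0.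
have -> // : A / Num.sqrt n%:R * (4 / Num.sqrt (log1 R n)) = 4 * A * p n.
by rewrite /p invfM; ring.
Qed.

(** The bilinear form of the estimate, by homogeneity: normalize [u] and [v]. *)
Lemma helson_schur_norm (R : realType) (A : R) (a : nat -> R) (u v : nat -> R) (N : nat) :
  0 <= A ->
  (forall n, (0 < n)%N -> 0 <= a n <= A / (Num.sqrt n%:R * log1 R n)) ->
  \sum_(1 <= n < N) \sum_(1 <= m < N) a (n * m)%N * (u n * v m) <=
    4 * A * Num.sqrt (\sum_(1 <= n < N) u n ^+ 2) * Num.sqrt (\sum_(1 <= n < N) v n ^+ 2).
Proof.
move=> A0 aA.
have zero w : \sum_(1 <= n < N) w n ^+ 2 = 0 -> forall n, (1 <= n < N)%N -> w n = 0 :> R.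
  move/eqP; rewrite psumr_eq0 => [|n _]; last exact: sqr_ge0.
  move=> /allP w0 n nN; have := w0 n; rewrite mem_index_iota nN => /(_ isT).
  by rewrite /= sqrf_eq0 => /eqP.
have sq_ge0 w : 0 <= \sum_(1 <= n < N) w n ^+ 2 :> R.
  by apply: sumr_ge0 => n _; exact: sqr_ge0.
set U := \sum_(1 <= n < N) u n ^+ 2; set V := \sum_(1 <= n < N) v n ^+ 2.
have [U0|U0] := eqVneq U 0.
  rewrite U0 sqrtr0 mulr0 mul0r big_nat big1// => n nN.
  by rewrite big1// => m _; rewrite (zero u)// mul0r mulr0.
have [V0|V0] := eqVneq V 0.
  rewrite V0 sqrtr0 mulr0 big1// => n _.
  by rewrite big_nat big1// => m mN; rewrite (zero v)// !mulr0.
have sU : 0 < Num.sqrt U by rewrite sqrtr_gt0 lt0r U0 sq_ge0.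
have sV : 0 < Num.sqrt V by rewrite sqrtr_gt0 lt0r V0 sq_ge0.
have nrm w W : W = \sum_(1 <= n < N) w n ^+ 2 -> 0 < Num.sqrt W ->
    \sum_(1 <= n < N) (w n / Num.sqrt W) ^+ 2 = 1 :> R.
  move=> WE W0; under eq_bigr do rewrite exprMn; rewrite -mulr_suml -WE exprVn.
  by rewrite sqr_sqrtr ?mulfV ?WE ?sq_ge0// -WE; move: W0; rewrite sqrtr_gt0 => /gt_eqF ->.
have := @helson_schur R A a (fun n => u n / Num.sqrt U) (fun n => v n / Num.sqrt V) N A0 aA.
rewrite !nrm//.
have -> : \sum_(1 <= n < N) \sum_(1 <= m < N)
    a (n * m)%N * (u n / Num.sqrt U * (v m / Num.sqrt V)) =
  (\sum_(1 <= n < N) \sum_(1 <= m < N) a (n * m)%N * (u n * v m))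
    / Num.sqrt U / Num.sqrt V.
  rewrite !mulr_suml; apply: eq_bigr => n _; rewrite !mulr_suml; apply: eq_bigr => m _.
  ring.
rewrite !ler_pdivrMr// => /le_trans; apply; rewrite le_eqVlt; apply/orP; left; apply/eqP.
ring.
Qed.

(** * Sums over the positive integers and integrals over the half-line *)

Lemma fsbig_posnat (V : nmodType) (F : nat -> V) (N : nat) :
  (forall n, posnat n -> (N <= n)%N -> F n = 0) ->
  \sum_(n \in posnat) F n = \sum_(1 <= n < N) F n.
Proof.
move=> F0; rewrite (fsbigE (index_iota 1 N)) ?iota_uniq//.
- rewrite big_nat_cond [RHS]big_nat_cond; apply: eq_bigl => n.
  by rewrite andbT; case: (boolP (1 <= n < N)%N) => [/andP[n0 _]|_]; rewrite ?andbF// mem_set.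
- by move=> n /=; rewrite mem_index_iota => /andP[].
- move=> n n0; rewrite mem_index_iota (n0 : (0 < n)%N)/= -leqNgt; exact: F0.
Qed.

Lemma finitely_supported_bound (R : realType) (f : nat -> R[i]) :
  finitely_supported f -> exists N, forall n, posnat n -> (N <= n)%N -> f n = 0.
Proof.
move=> /finite_seqP[s fs]; exists (\max_(i <- s) i).+1 => n n0 Nn.
apply/eqP/negP => /negP fn0; have : [set n | posnat n /\ f n != 0] n by [].
rewrite fs /= => ns; have := @leq_bigmax_seq nat s xpredT id n ns isT.
by rewrite leqNgt Nn.
Qed.

Lemma measurable_half_line (R : realType) : measurable (half_line R).
Proof. exact: measurable_itv. Qed.
#[local] Hint Resolve measurable_half_line : core.

Lemma half_lineE (R : realType) (s : R) : half_line R s = (2^-1 < s) :> Prop.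
Proof. by rewrite /half_line /= in_itv /= andbT. Qed.

Definition near_half (R : realType) (e : R) : set (measurableTypeR R) :=
  `](2^-1)%R, 2^-1 + e]%classic.

Lemma measurable_near_half (R : realType) (e : R) : measurable (near_half e).
Proof. exact: measurable_itv. Qed.
#[local] Hint Resolve measurable_near_half : core.

Lemma near_halfE (R : realType) (e s : R) :
  near_half e s = (2^-1 < s <= 2^-1 + e) :> Prop.
Proof. by rewrite /near_half /= in_itv. Qed.

Lemma near_half_sub (R : realType) (e : R) : near_half e `<=` half_line R.
Proof. by move=> s; rewrite near_halfE half_lineE => /andP[]. Qed.

Section Integrals.
Context {R : realType} (nu : {finite_measure set (measurableTypeR R) -> \bar R}).
Local Notation D := (half_line R).

(** Real-valued, which is legitimate as [nu] is finite. *)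
Definition near_mass (e : R) : R := fine (nu (near_half e)).

Lemma near_massE (e : R) : (near_mass e)%:E = nu (near_half e).
Proof. by rewrite fineK// fin_num_measure. Qed.

Lemma near_mass_ge0 (e : R) : 0 <= near_mass e.
Proof. by rewrite fine_ge0. Qed.

Lemma near_mass_le (e : R) : near_mass e <= fine (nu D).
Proof.
rewrite fine_le ?fin_num_measure//; apply: le_measure; rewrite ?inE//.
exact: near_half_sub.
Qed.

Lemma bounded_integrable (f : measurableTypeR R -> R) (M : R) :
  measurable_fun D f -> (forall s, D s -> `|f s| <= M) -> nu.-integrable D (EFin \o f).
Proof.
move=> mf fM; apply: measurable_bounded_integrable => //.
  by rewrite ltey_eq fin_num_measure.
exists M; split; first exact: num_real.
by move=> x Mx s Ds; apply: le_trans (fM s Ds) (ltW Mx).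
Qed.

Lemma cst_integrable (c : R) : nu.-integrable D (EFin \o cst c).
Proof. by apply: (@bounded_integrable _ `|c|). Qed.

Lemma sum_integrable (I : Type) (r : seq I) (h : I -> measurableTypeR R -> R) :
  (forall i, nu.-integrable D (EFin \o h i)) ->
  nu.-integrable D (EFin \o (fun s => \sum_(i <- r) h i s)).
Proof.
move=> inth.
have -> : EFin \o (fun s : measurableTypeR R => \sum_(i <- r) h i s) =
    (fun s => \sum_(i <- r) (h i s)%:E)%E.
  by apply/funext => s /=; rewrite sumEFin.
by apply: integrable_sum => // i _; exact: inth.
Qed.

Lemma Rintegral_sum (I : Type) (r : seq I) (h : I -> measurableTypeR R -> R) :
  (forall i, nu.-integrable D (EFin \o h i)) ->
  Rintegral nu D (fun s => \sum_(i <- r) h i s) = \sum_(i <- r) Rintegral nu D (h i).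
Proof.
move=> inth; elim: r => [|i r IH].
  rewrite big_nil; under eq_Rintegral do rewrite big_nil.
  by rewrite Rintegral_cst// mul0r.
rewrite big_cons -IH -RintegralD//; last exact: sum_integrable.
by apply: eq_Rintegral => s _; rewrite big_cons.
Qed.

Lemma indic_integrable (c e : R) :
  nu.-integrable D (EFin \o (fun s => c * \1_(near_half e) s)).
Proof.
apply: (@bounded_integrable _ `|c|).
  apply: measurable_funM => //; exact: measurable_indic.
move=> s _; rewrite normrM indicE; case: (_ \in _); rewrite ?normr1 ?mulr1//.
by rewrite normr0 mulr0.
Qed.

Lemma Rintegral_indic (c e : R) :
  Rintegral nu D (fun s => c * \1_(near_half e) s) = c * near_mass e.
Proof.
have h : nu.-integrable D (EFin \o (fun s => \1_(near_half e) s : R)).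
  by have := indic_integrable 1 e; under eq_fun do rewrite mul1r.
rewrite RintegralZl//; congr (_ * _); rewrite /Rintegral integral_indic//.
rewrite /near_mass; congr (fine (nu _)); apply/setIidl; exact: near_half_sub.
Qed.

Lemma Rintegral_ge_near (c e : R) (f : measurableTypeR R -> R) :
  nu.-integrable D (EFin \o f) -> (forall s, D s -> 0 <= f s) ->
  (forall s, near_half e s -> c <= f s) -> c * near_mass e <= Rintegral nu D f.
Proof.
move=> intf f0 cf; rewrite -Rintegral_indic; apply: le_Rintegral => //.
  exact: indic_integrable.
move=> s Ds; rewrite indicE; case: (boolP (s \in near_half e)) => [|_].
  by rewrite inE mulr1 => /cf.
by rewrite mulr0 f0.
Qed.

Lemma measurable_dirichlet (n : nat) :
  measurable_fun D (fun s : measurableTypeR R => n%:R `^ (- s) : R).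
Proof.
apply: (@measurableT_comp _ _ _ _ _ _ (powR n%:R) _ (fun s : measurableTypeR R => - s)).
  exact: measurable_powRr.
exact: measurable_funN.
Qed.

Lemma dirichlet_le (n : nat) (s : R) : D s -> 0 <= n%:R `^ (- s) <= 1.
Proof.
rewrite half_lineE powR_ge0 => s2 /=.
have s0 : 0 < s by rewrite (lt_trans _ s2)// invr_gt0.
(* At [n = 0] the power is [0], its exponent being nonzero. *)
case: n => [|n]; first by rewrite powR0 ?oppr_eq0 ?gt_eqF.
by rewrite -[leRHS](powRr0 n.+1%:R) ler_powR ?ler1n// oppr_le0 ltW.
Qed.

Lemma dirichlet_integrable (n : nat) :
  nu.-integrable D (EFin \o (fun s => n%:R `^ (- s))).
Proof.
apply: (@bounded_integrable _ 1); first exact: measurable_dirichlet.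
by move=> s /(dirichlet_le n)/andP[h0 h1]; rewrite ger0_norm.
Qed.

Local Notation alpha := (dirichlet_moment nu).

Lemma dirichlet_moment_ge0 (n : nat) : 0 <= alpha n.
Proof. by apply: Rintegral_ge0 => s _; exact: powR_ge0. Qed.

Lemma near_mass_linear (c : R) : 0 < c ->
  (forall e, 0 < e -> near_mass e <= c * e) ->
  \forall s \near (2^-1 : R)^'+, (nu `](2^-1)%R, s]%classic <= (c * (s - 2^-1))%:E)%E.
Proof.
move=> c0 h; near=> s; have s0 : 2^-1 < s by near: s; exact: nbhs_right_gt.
have -> : `]2^-1, s]%classic = near_half (s - 2^-1) by rewrite /near_half subrKC.
by rewrite -near_massE lee_fin h// subr_gt0.
Unshelve. all: by end_near. Qed.

(** Away from [1/2] the linear bound costs only a larger constant, because the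
    total mass is finite. *)
Lemma near_mass_linear_inv (c : R) : 0 < c ->
  (\forall s \near (2^-1 : R)^'+, (nu `](2^-1)%R, s]%classic <= (c * (s - 2^-1))%:E)%E) ->
  exists2 c' : R, 0 < c' & forall e, 0 < e -> near_mass e <= c' * e.
Proof.
move=> c0 /nbhs_right0P[d /= d0 h].
have e0 : 0 < d / 2 by rewrite divr_gt0.
exists (c + fine (nu D) / (d / 2)) => [|e ep].
  by rewrite ltr_pwDl// divr_ge0 ?fine_ge0// ltW.
rewrite mulrDl; case: (leP e (d / 2)) => ed.
  apply: (@le_trans _ _ (c * e)).
    have := h e; rewrite /= sub0r normrN gtr0_norm// => /(_ _ ep).
    rewrite -near_massE lee_fin [2^-1 + e]addrC addrK; apply; lra.
  by rewrite lerDl mulr_ge0 ?(ltW ep)// divr_ge0 ?fine_ge0// ltW.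
apply: (le_trans (near_mass_le e)).
rewrite -[leLHS]add0r lerD//; first by rewrite mulr_ge0// ltW.
rewrite mulrAC ler_pdivlMr// ler_wpM2l ?fine_ge0//; exact: ltW.
Qed.

End Integrals.

(** * Mass near one half and decay of the moments *)

Lemma modulus_real (R : realType) (x : R) : modulus x%:C = `|x|.
Proof. by rewrite /modulus /= expr0n addr0 sqrtr_sqr. Qed.

Lemma conjC_real (R : realType) (x : R) : (x%:C : R[i])^*%R = x%:C.
Proof. by rewrite conj_Creal// complex_real. Qed.

Section Moments.
Context {R : realType} (nu : {finite_measure set (measurableTypeR R) -> \bar R}).
Local Notation D := (half_line R).
Local Notation alpha := (dirichlet_moment nu).

(** If [k < y <= k + 1] with [k < K], the [k]-th term alone suffices, as
    [exp (- k) <= 2 ^ (- k)]; the last summand covers [y > K].  Keeping [K] finite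
    leaves only finite sums to integrate. *)
Lemma expR_le_dyadic (y : R) (K : nat) : 0 < y ->
  expR (- y) <= \sum_(0 <= k < K) 2^-1 ^+ k * (y <= k.+1%:R)%R%:R + 2^-1 ^+ K.
Proof.
move=> y0; have e2 : expR (-1) <= 2^-1 :> R.
  rewrite expRN lef_pV2 ?posrE ?expR_gt0//.
  by have := @expR_ge1Dx R 1; lra.
elim: K => [|K IH].
  by rewrite big_geq// add0r expr0 -expR0 ler_expR oppr_le0 ltW.
have S0 : 0 <= \sum_(0 <= k < K) 2^-1 ^+ k * (y <= k.+1%:R)%R%:R :> R.
  by apply: sumr_ge0 => k _; rewrite mulr_ge0// exprn_ge0.
rewrite big_nat_recr//=; case: (leP y K.+1%:R) => yK /=.
  rewrite mulr1; apply: (le_trans IH).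
  by rewrite lerDl exprn_ge0.
rewrite mulr0 addr0 -[leLHS]add0r lerD//.
apply: (@le_trans _ _ (expR (-1) ^+ K.+1)).
  by rewrite -expRM_natl ler_expR mulrN1 lerN2 ltW.
by rewrite lerXn2r ?nnegrE ?expR_ge0 ?invr_ge0.
Qed.

Lemma sum_arith_geometric (K : nat) :
  \sum_(0 <= k < K) 2^-1 ^+ k * k.+1%:R <= 4 :> R.
Proof.
suff -> : \sum_(0 <= k < K) 2^-1 ^+ k * k.+1%:R = 4 - (2 * K%:R + 4) * 2^-1 ^+ K :> R.
  by rewrite gerBl mulr_ge0 ?exprn_ge0// addr_ge0// mulr_ge0.
elim: K => [|K IH]; first by rewrite big_geq// expr0; ring.
by rewrite big_nat_recr//= {}IH exprS -natr1; field.
Qed.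

(** Apply [expR_le_dyadic] with [y = (s - 1/2) * ln n]: the [k]-th indicator has
    mass at most [c * (k + 1) / ln n], and the coefficients [2 ^ (- k)] make the
    sum converge.  The remainder [2 ^ (- K)] is below [1 / ln n] once
    [K > ln n]. *)
Lemma decay_of_linear_mass (c : R) : 0 < c ->
  (forall e, 0 < e -> near_mass nu e <= c * e) ->
  exists2 C : R, 0 < C & forall n, (2 <= n)%N ->
    alpha n <= C / (Num.sqrt n%:R * ln n%:R).
Proof.
move=> c0 hc; exists (4 * c + fine (nu D)).
  by rewrite ltr_pwDl ?mulr_gt0// fine_ge0.
move=> n n2; have n0 : (0 < n)%N by exact: leq_trans n2.
set L := ln n%:R; have L0 : 0 < L by rewrite ln_gt0// ltr1n.
pose K := (Num.trunc L).+1.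
have KL : 2^-1 ^+ K <= L^-1 :> R.
  rewrite exprVn lef_pV2 ?posrE ?exprn_gt0//.
  apply: (le_trans (ltW (truncnS_gt L))); rewrite -/K -natrX ler_nat.
  by rewrite ltnW// ltn_expl.
pose q : R := n%:R `^ (- 2^-1).
have qE : q = (Num.sqrt n%:R)^-1 by rewrite /q powRN powR12_sqrt// ler0n.
have q0 : 0 <= q by rewrite /q powR_ge0.
pose g (s : measurableTypeR R) : R :=
  \sum_(0 <= k < K) q * 2^-1 ^+ k * \1_(near_half (k.+1%:R / L)) s + q * 2^-1 ^+ K.
have intS : nu.-integrable D (EFin \o (fun s =>
    \sum_(0 <= k < K) q * 2^-1 ^+ k * \1_(near_half (k.+1%:R / L)) s)).
  by apply: sum_integrable => k; exact: indic_integrable.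
have intc : nu.-integrable D (EFin \o cst (q * 2^-1 ^+ K)) by exact: cst_integrable.
have ag : alpha n <= Rintegral nu D g.
  apply: le_Rintegral => //; first exact: dirichlet_integrable.
    by have := integrableD (@measurable_half_line R) intS intc.
  move=> s; rewrite half_lineE => s2.
  have -> : n%:R `^ (- s) = q * expR (- ((s - 2^-1) * L)).
    rewrite powRN_expR// /q powRN_expR// -expRD -/L; congr expR; ring.
  have y0 : 0 < (s - 2^-1) * L by rewrite mulr_gt0// subr_gt0.
  apply: (le_trans (ler_wpM2l q0 (expR_le_dyadic K y0))).
  rewrite mulrDr /g mulr_sumr; rewrite lerD2r; apply: ler_sum_nat => k _.
  rewrite mulrA ler_wpM2l ?mulr_ge0 ?exprn_ge0// indicE.
  rewrite -ler_pdivlMr// lerBlDl.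
  have -> // : s \in near_half (k.+1%:R / L) = (s <= 2^-1 + k.+1%:R / L).
  by apply/idP/idP; rewrite ?inE near_halfE s2.
apply: (le_trans ag); rewrite /g RintegralD//.
rewrite Rintegral_sum => [|k]; last exact: indic_integrable.
rewrite Rintegral_cst// invfM -qE mulrA.
have -> : (4 * c + fine (nu D)) * q / L = q * (4 * (c / L) + L^-1 * fine (nu D)).
  by field; rewrite gt_eqF.
rewrite mulrDr -[_ * _ * fine _]mulrA lerD//; last first.
  by rewrite ler_wpM2l// ler_wpM2r// fine_ge0.
apply: (@le_trans _ _ (q * (\sum_(0 <= k < K) 2^-1 ^+ k * k.+1%:R * (c / L)))).
  rewrite mulr_sumr; apply: ler_sum_nat => k _; rewrite Rintegral_indic.
  rewrite -!mulrA ler_wpM2l// ler_wpM2l ?exprn_ge0//.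
  by rewrite (le_trans (hc _ _)) ?divr_gt0// mulrA [c * _]mulrC mulrA.
rewrite ler_wpM2l// -mulr_suml ler_wpM2r ?sum_arith_geometric//.
by rewrite divr_ge0 ?ltW.
Qed.

(** For [n >= 2], [log1 n] and [ln n] are comparable, [ln 2] being the smallest
    value of [ln n]. *)
Lemma decay_log1 (C : R) : 0 < C ->
  (forall n, (2 <= n)%N -> alpha n <= C / (Num.sqrt n%:R * ln n%:R)) ->
  exists2 A : R, 0 < A & forall n, (0 < n)%N ->
    0 <= alpha n <= A / (Num.sqrt n%:R * log1 R n).
Proof.
move=> C0 hC; have l2 : 0 < ln 2 :> R by rewrite ln_gt0// ltr1n.
exists (alpha 1 + C * (1 + (ln 2)^-1)).
  rewrite ltr_wpDl ?dirichlet_moment_ge0// mulr_gt0// addr_gt0// invr_gt0//.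
have A0 : 0 <= C * (1 + (ln 2)^-1) by rewrite mulr_ge0 ?addr_ge0 ?invr_ge0 ?(ltW l2) ?ltW.
case=> [//|[_|n _]]; rewrite dirichlet_moment_ge0/=.
  by rewrite /log1 ln1 addr0 sqrtr1 mul1r divr1 lerDl.
set m := n.+2; have m0 : 0 < Num.sqrt m%:R :> R by rewrite sqrtr_gt0 ltr0n.
have lm : ln 2 <= ln m%:R :> R by rewrite ler_ln ?posrE ?ltr0n ?ler_nat.
have lm0 : 0 < ln m%:R :> R by exact: lt_le_trans lm.
have ll0 : 0 < log1 R m by rewrite ltr_pwDl// ltW.
have swap (x y z : R) : x / (y * z) = x / z / y by rewrite invfM mulrA mulrAC.
apply: (le_trans (hC m isT)); rewrite !swap ler_wpM2r ?invr_ge0 ?(ltW m0)//.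
rewrite ler_pdivrMr// mulrAC ler_pdivlMr//.
apply: (@le_trans _ _ (C * (1 + (ln 2)^-1) * ln m%:R)); last first.
  by rewrite ler_wpM2r ?(ltW lm0)// lerDr dirichlet_moment_ge0.
rewrite -mulrA ler_wpM2l ?(ltW C0)// /log1 mulrDl mul1r addrC lerD2l.
by rewrite mulrC ler_pdivlMr// mul1r.
Qed.

(** Test on [u n = n ^ (- 1/2)] for [n < N], with [N] the cut-off of [e] and [H]
    the harmonic sum up to it.  On [(1/2, 1/2 + e]] the function
    [(n * m) ^ (- s)] is at least [exp (- 2) * u n * u m], so the form is at
    least [exp (- 2) * nu (1/2, 1/2 + e] * H ^ 2], against [C * H]; and
    [H >= 1 / e]. *)
Lemma linear_mass_of_helson_bounded :
  l2_bounded_matrix (helson_matrix (fun n => (alpha n)%:C)) ->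
  exists2 c : R, 0 < c & forall e, 0 < e -> near_mass nu e <= c * e.
Proof.
move=> [C hC]; exists (expR 2 * Num.max C 1).
  by rewrite mulr_gt0 ?expR_gt0// lt_max ltr01 orbT.
move=> e e0; have [N [N1 HN lN]] := harmonic_cutoff e0.
pose u n : R := if (n < N)%N then n%:R `^ (- 2^-1) else 0.
pose H : R := \sum_(1 <= n < N) n%:R^-1.
have H0 : 0 < H by apply: lt_le_trans HN; rewrite invr_gt0.
have u0 n : (N <= n)%N -> u n = 0 by rewrite /u leqNgt => /negbTE ->.
have uge0 n : 0 <= u n by rewrite /u; case: ifP => // _; exact: powR_ge0.
have fu : finitely_supported (fun n => (u n)%:C).
  apply: (@sub_finite_set _ _ `I_N); last exact: finite_II.
  move=> n /= [_]; apply: contraNT; rewrite -leqNgt => /u0 ->; exact: eqxx.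
have uu n : (1 <= n < N)%N -> u n ^+ 2 = n%:R^-1.
  move=> /andP[n0 nN]; rewrite /u nN expr2 -powRD ?pnatr_eq0 ?gtn_eqF ?implybT//.
  have -> : - 2^-1 + - 2^-1 = - 1 :> R by field.
  by rewrite powR_inv1 ?ler0n.
have norm_u : fin_l2norm (fun n => (u n)%:C) = Num.sqrt H.
  rewrite /fin_l2norm (@fsbig_posnat _ _ N); last first.
    by move=> n _ /u0 ->; rewrite modulus_real normr0 expr0n.
  congr Num.sqrt; apply: eq_big_nat => n nN.
  by rewrite modulus_real real_normK ?num_real// uu.
have := hC _ _ fu fu; rewrite norm_u -mulrA -expr2 sqr_sqrtr ?(ltW H0)//.
rewrite (@fsbig_posnat _ _ N); last first.
  move=> n _ nN; rewrite fsbig1// => m _; rewrite u0//.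
  by rewrite mulr0 mul0r.
have -> : \sum_(1 <= n < N) \sum_(m \in posnat)
    helson_matrix (fun n => (alpha n)%:C) n m * (u n)%:C * ((u m)%:C)^* =
  (\sum_(1 <= n < N) \sum_(1 <= m < N) alpha (n * m)%N * (u n * u m))%:C.
  rewrite rmorph_sum; apply: eq_bigr => n _.
  rewrite (@fsbig_posnat _ _ N); last first.
    by move=> m _ mN; rewrite (u0 m)// conjC_real mulr0.
  rewrite rmorph_sum; apply: eq_bigr => m _.
  by rewrite conjC_real /helson_matrix !rmorphM/= mulrA.
rewrite modulus_real => hS.
have lower : expR (-2) * near_mass nu e * H ^+ 2 <=
    \sum_(1 <= n < N) \sum_(1 <= m < N) alpha (n * m)%N * (u n * u m).
  rewrite expr2 mulrA {2}/H [leLHS]mulr_sumr; apply: ler_sum_nat => n nN.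
  rewrite mulrAC /H [leLHS]mulr_sumr; apply: ler_sum_nat => m mN.
  have c_le : expR (-2) * (u n * u m) * near_mass nu e <= alpha (n * m)%N.
    apply: Rintegral_ge_near; first exact: dirichlet_integrable.
      by move=> s _; exact: powR_ge0.
    move=> s; rewrite near_halfE => /andP[s2 se].
    have /andP[n0 ltnN] := nN; have /andP[m0 ltmN] := mN.
    apply: (@le_trans _ _ ((n * m)%:R `^ (- (2^-1 + e)))); last first.
      by rewrite ler_powR ?lerN2// ler1n muln_gt0 n0.
    rewrite natrM powRM ?ler0n// (opprD 2^-1 e) !powRD ?pnatr_eq0 ?gtn_eqF ?implybT//.
    rewrite /u ltnN ltmN; set x := _ `^ _; set y := _ `^ _.
    have -> : -2 = -1 + -1 :> R by ring.
    rewrite expRD mulrC [leRHS]mulrACA.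
    by rewrite ler_wpM2l ?mulr_ge0 ?powR_ge0// ler_pM ?expR_ge0 ?lN.
  apply: le_trans (ler_wpM2r _ c_le); last by rewrite mulr_ge0.
  rewrite -(uu _ nN) -(uu _ mN) le_eqVlt; apply/orP; left; apply/eqP; ring.
have hSH : expR (-2) * near_mass nu e * H ^+ 2 <= C * H.
  by apply: le_trans hS; apply: le_trans lower _; exact: ler_norm.
have M0 := near_mass_ge0 nu e.
have : expR (-2) * near_mass nu e * e^-1 <= Num.max C 1.
  apply: (@le_trans _ _ (expR (-2) * near_mass nu e * H)).
    by rewrite ler_wpM2l// mulr_ge0 ?expR_ge0.
  by rewrite le_max; apply/orP; left; rewrite expr2 mulrA ler_pM2r in hSH.
by rewrite expRN -mulrA ler_pdivrMl ?expR_gt0// ler_pdivrMr.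
Qed.

End Moments.

(** * Boundedness of the matrix and of the zeta operator *)

Lemma modulusE (R : realType) (z : R[i]) : (modulus z)%:C = `|z|.
Proof. by []. Qed.

Lemma modulusM (R : realType) (z w : R[i]) : modulus (z * w) = modulus z * modulus w.
Proof. by apply: complexI; rewrite rmorphM/= !modulusE normrM. Qed.

Lemma modulus_conj (R : realType) (z : R[i]) : modulus (z^*)%R = modulus z.
Proof. by apply: complexI; rewrite !modulusE norm_conjC. Qed.

Lemma modulus_sum (R : realType) (I : Type) (r : seq I) (F : I -> R[i]) :
  modulus (\sum_(i <- r) F i) <= \sum_(i <- r) modulus (F i).
Proof. by rewrite -lecR rmorph_sum modulusE; exact: ler_norm_sum. Qed.

Lemma sqr_modulus (R : realType) (z : R[i]) :
  modulus z ^+ 2 = complex.Re z ^+ 2 + complex.Im z ^+ 2.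
Proof. by case: z => a b; rewrite /modulus /= sqr_sqrtr// addr_ge0 ?sqr_ge0. Qed.

Section Operators.
Context {R : realType} (nu : {finite_measure set (measurableTypeR R) -> \bar R}).
Local Notation D := (half_line R).
Local Notation alpha := (dirichlet_moment nu).

Lemma helson_bounded_of_decay (A : R) : 0 <= A ->
  (forall n, (0 < n)%N -> 0 <= alpha n <= A / (Num.sqrt n%:R * log1 R n)) ->
  l2_bounded_matrix (helson_matrix (fun n => (alpha n)%:C)).
Proof.
move=> A0 hA; exists (4 * A) => f g fin_f fin_g.
have [N1 f0] := finitely_supported_bound fin_f.
have [N2 g0] := finitely_supported_bound fin_g.
pose N := maxn N1 N2.
have {}f0 n : posnat n -> (N <= n)%N -> f n = 0.
  by move=> n0; rewrite geq_max => /andP[h _]; exact: f0.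
have {}g0 n : posnat n -> (N <= n)%N -> g n = 0.
  by move=> n0; rewrite geq_max => /andP[_ h]; exact: g0.
have l2 h : (forall n, posnat n -> (N <= n)%N -> h n = 0) ->
    fin_l2norm h = Num.sqrt (\sum_(1 <= n < N) modulus (h n) ^+ 2) :> R.
  move=> h0; rewrite /fin_l2norm (@fsbig_posnat _ _ N)// => n n0 nN.
  by rewrite h0// (@modulus_real R 0) normr0 expr0n.
rewrite !l2// (@fsbig_posnat _ _ N); last first.
  by move=> n n0 nN; rewrite fsbig1// => m _; rewrite f0// mulr0 mul0r.
apply: (le_trans (modulus_sum _ _)).
apply: (le_trans _ (helson_schur_norm (fun n => modulus (f n)) (fun n => modulus (g n)) N A0 hA)).
apply: ler_sum_nat => n _; rewrite (@fsbig_posnat _ _ N); last first.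
  by move=> m m0 mN; rewrite (g0 m)// conjC0 mulr0.
apply: (le_trans (modulus_sum _ _)); apply: ler_sum_nat => m _.
rewrite !modulusM modulus_conj modulus_real ger0_norm ?dirichlet_moment_ge0//.
by rewrite mulrA.
Qed.

Lemma half_line_add (s t : R) : D s -> D t -> 1 < s + t.
Proof. rewrite !half_lineE => s2 t2; lra. Qed.

Lemma measurable_zeta_sum (N : nat) (t : R) :
  measurable_fun D (fun s : measurableTypeR R => \sum_(1 <= n < N) n%:R `^ (- (s + t)) : R).
Proof.
apply: measurable_sum => n.
apply: (@measurableT_comp _ _ _ _ _ _ (powR n%:R) _ (fun s : measurableTypeR R => - (s + t))).
  exact: measurable_powRr.
by apply: measurable_funN; exact: measurable_funD.
Qed.

Lemma measurable_zeta (t : R) : D t ->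
  measurable_fun D (fun s : measurableTypeR R => zeta (s + t)).
Proof.
move=> Dt; apply: (@measurable_fun_cvg _ _ _ _
    (fun N (s : measurableTypeR R) => \sum_(1 <= n < N) n%:R `^ (- (s + t)) : R)).
  by move=> N; exact: measurable_zeta_sum.
by move=> s Ds; apply: zeta_sum_cvg; exact: half_line_add.
Qed.

Lemma zeta_sum_half_le (s t : R) (N : nat) : D s -> D t ->
  0 <= \sum_(1 <= n < N) n%:R `^ (- (s + t)) <= 1 + (t - 2^-1)^-1.
Proof.
rewrite !half_lineE => s2 t2; apply/andP; split.
  by apply: sumr_ge0 => n _; exact: powR_ge0.
apply: (@le_trans _ _ (1 + (s + t - 1)^-1)); last first.
  by rewrite lerD2l lef_pV2 ?posrE; lra.
have {1}-> : s + t = 1 + (s + t - 1) by ring.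
by apply: zeta_sum_le; lra.
Qed.

Lemma zeta_half_le (s t : R) : D s -> D t ->
  0 <= zeta (s + t) <= 1 + (t - 2^-1)^-1.
Proof.
move=> Ds Dt; have hst := half_line_add Ds Dt; apply/andP; split.
  have /andP[h _] := zeta_sum_half_le 0 Ds Dt.
  exact: le_trans h (zeta_sum_le_zeta 0 hst).
apply: limr_le; first by apply/cvg_ex; eexists; exact: zeta_sum_cvg.
by apply: nearW => N; case/andP: (zeta_sum_half_le N Ds Dt).
Qed.

Lemma in_L2_integrable f : in_L2 nu f ->
  nu.-integrable D (EFin \o (fun s => modulus (f s) ^+ 2)).
Proof.
move=> [mRe mIm fin]; apply/integrableP; split.
  apply/measurable_EFinP; under eq_fun do rewrite sqr_modulus.
  by apply: measurable_funD; exact: measurable_funX.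
by under eq_integral do rewrite /= ger0_norm ?sqr_ge0//.
Qed.

Lemma Re_zeta_operator f t : complex.Re (zeta_operator nu f t) =
  Rintegral nu D (fun s => zeta (s + t) * complex.Re (f s)).
Proof.
by apply: eq_Rintegral => s _; case: (f s) => a b /=; rewrite mul0r subr0.
Qed.

Lemma Im_zeta_operator f t : complex.Im (zeta_operator nu f t) =
  Rintegral nu D (fun s => zeta (s + t) * complex.Im (f s)).
Proof.
by apply: eq_Rintegral => s _; case: (f s) => a b /=; rewrite mul0r addr0.
Qed.

(** With [f] the indicator of [(1/2, 1/2 + e]] and [M] its mass, the image of [f]
    is at least [exp (- 2) / e * M] on that same interval, by [zeta_ge].  Hence
    [(exp (- 2) / e * M) ^ 2 * M <= C ^ 2 * M]. *)
Lemma linear_mass_of_zeta_bounded : L2_bounded_operator nu (zeta_operator nu) ->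
  exists2 c : R, 0 < c & forall e, 0 < e -> near_mass nu e <= c * e.
Proof.
move=> [C hC]; exists (expR 2 * (`|C| + 1)).
  by rewrite mulr_gt0 ?expR_gt0// ltr_wpDl.
move=> e e0; set M := near_mass nu e; have M0 : 0 <= M by exact: near_mass_ge0.
pose f (s : measurableTypeR R) : R[i] := (\1_(near_half e) s)%:C.
have fsq s : modulus (f s) ^+ 2 = 1 * \1_(near_half e) s.
  rewrite modulus_real real_normK ?num_real// mul1r indicE.
  by case: (_ \in _); rewrite ?expr0n ?expr1n.
have norm_f : L2norm nu f = Num.sqrt M.
  rewrite /L2norm; under eq_Rintegral do rewrite fsq.
  by rewrite Rintegral_indic mul1r.
have f2 : in_L2 nu f.
  split; first exact: measurable_indic.
    exact: measurable_cst.
  under eq_integral do rewrite fsq mul1r.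
  by rewrite integral_indic// ltey_eq fin_num_measure//; exact: measurableI.
have [[mRe mIm fin] le_norm] := hC f f2.
pose k := expR (-2) / e.
have k0 : 0 < k by rewrite divr_gt0 ?expR_gt0.
have int_sq := in_L2_integrable (hC f f2).1.
have big t : near_half e t -> (k * M) ^+ 2 <= modulus (zeta_operator nu f t) ^+ 2.
  move=> Et; have Dt := near_half_sub Et.
  suff h : k * M <= complex.Re (zeta_operator nu f t).
    rewrite sqr_modulus ler_wpDr ?sqr_ge0// lerXn2r// nnegrE.
      by rewrite mulr_ge0 ?(ltW k0).
    by rewrite (le_trans _ h)// mulr_ge0 ?(ltW k0).
  rewrite Re_zeta_operator; apply: Rintegral_ge_near.
  - apply: (@bounded_integrable _ _ _ (1 + (t - 2^-1)^-1)).
      by apply: measurable_funM; [exact: measurable_zeta|exact: measurable_indic].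
    move=> s Ds; have /andP[z0 z1] := zeta_half_le Ds Dt.
    rewrite /= indicE; case: (_ \in _); rewrite /= ?mulr1 ?mulr0 ?normr0 ?ger0_norm//.
    exact: le_trans z1.
  - move=> s Ds; have /andP[z0 _] := zeta_half_le Ds Dt.
    by rewrite /= mulr_ge0// indicE.
  - move=> s Es; rewrite /f /= indicE mem_set// mulr1; apply: zeta_ge => //.
    rewrite half_line_add//=; last exact: near_half_sub Es.
    by move: Es Et; rewrite !near_halfE => /andP[_ a] /andP[_ b]; lra.
have h1 : (k * M) ^+ 2 * M <= L2norm nu (zeta_operator nu f) ^+ 2.
  rewrite sqr_sqrtr ?Rintegral_ge0//; last by move=> s _; exact: sqr_ge0.
  by apply: Rintegral_ge_near => // s _; exact: sqr_ge0.
have [->|M_neq0] := eqVneq M 0; first by rewrite !mulr_ge0 ?expR_ge0// ltW.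
have Mpos : 0 < M by rewrite lt0r M_neq0.
have h2 : (k * M) ^+ 2 <= `|C| ^+ 2.
  rewrite -(ler_pM2r Mpos) (le_trans h1)// -(sqr_sqrtr M0) -exprMn.
  apply: lerXn2r; rewrite ?nnegrE.
  - exact: sqrtr_ge0.
  - by rewrite mulr_ge0 ?sqrtr_ge0.
  - rewrite -norm_f (le_trans le_norm)// ler_wpM2r ?sqrtr_ge0// ler_norm//.
have : k * M <= `|C| + 1.
  rewrite (@le_trans _ _ `|C|)// ?lerDl//.
  by rewrite ler_pXn2r ?nnegrE// in h2; rewrite mulr_ge0 ?(ltW k0).
have -> : expR 2 * (`|C| + 1) * e = (`|C| + 1) * e * expR 2 by ring.
by rewrite /k expRN mulrAC ler_pdivrMr// mulrC ler_pdivrMr ?expR_gt0.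
Qed.

Definition square_integrable (f : measurableTypeR R -> R) :=
  measurable_fun D f /\ nu.-integrable D (EFin \o (fun s => f s ^+ 2)).

Lemma square_integrable_integrable f : square_integrable f -> nu.-integrable D (EFin \o f).
Proof.
move=> [mf f2]; apply: (@le_integrable _ _ _ nu D _ _ (EFin \o (fun s => 1 + f s ^+ 2))) => //.
- exact/measurable_EFinP.
- move=> s _ /=; rewrite lee_fin [leRHS]ger0_norm ?addr_ge0 ?sqr_ge0//.
  by rewrite ler_norml; apply/andP; split; nra.
- by have := integrableD (@measurable_half_line R) (cst_integrable nu 1) f2.
Qed.

Lemma dirichletM_integrable (n : nat) f : square_integrable f ->
  nu.-integrable D (EFin \o (fun s => n%:R `^ (- s) * f s)).
Proof.
move=> f2; apply: (@le_integrable _ _ _ nu D _ _ (EFin \o f)) => //.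
- apply/measurable_EFinP; apply: measurable_funM; last exact: f2.1.
  exact: measurable_dirichlet.
- move=> s Ds /=; have /andP[h0 h1] := dirichlet_le n Ds.
  by rewrite lee_fin normrM ger0_norm// ler_piMl.
- exact: square_integrable_integrable.
Qed.

Definition dirichlet_poly (u : nat -> R) (N : nat) (s : measurableTypeR R) : R :=
  \sum_(1 <= n < N) u n * n%:R `^ (- s).

Lemma dirichlet_poly_measurable u N : measurable_fun D (dirichlet_poly u N).
Proof.
by apply: measurable_sum => n; apply: measurable_funM => //; exact: measurable_dirichlet.
Qed.

Lemma dirichlet_poly_sqr u N (s : R) : dirichlet_poly u N s ^+ 2 =
  \sum_(1 <= n < N) \sum_(1 <= m < N) u n * u m * (n * m)%:R `^ (- s).
Proof.
rewrite expr2 mulr_suml; apply: eq_bigr => n _; rewrite mulr_sumr.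
by apply: eq_bigr => m _; rewrite natrM powRM ?ler0n//; ring.
Qed.

Lemma dirichlet_poly_sqr_integrable u N :
  nu.-integrable D (EFin \o (fun s => dirichlet_poly u N s ^+ 2)).
Proof.
under eq_fun do rewrite /= dirichlet_poly_sqr.
apply: sum_integrable => n; apply: sum_integrable => m.
by have := integrableZl (@measurable_half_line R) (u n * u m) (dirichlet_integrable nu (n * m)).
Qed.

Lemma Rintegral_dirichlet_poly_sqr u N :
  Rintegral nu D (fun s => dirichlet_poly u N s ^+ 2) =
  \sum_(1 <= n < N) \sum_(1 <= m < N) alpha (n * m)%N * (u n * u m).
Proof.
have int n m : nu.-integrable D (EFin \o (fun s => u n * u m * (n * m)%:R `^ (- s))).
  by have := integrableZl (@measurable_half_line R) (u n * u m) (dirichlet_integrable nu (n * m)).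
under eq_Rintegral do rewrite dirichlet_poly_sqr.
rewrite Rintegral_sum => [|n]; last by apply: sum_integrable => m; exact: int.
apply: eq_bigr => n _; rewrite Rintegral_sum// ; apply: eq_bigr => m _.
by rewrite RintegralZl// 1?mulrC//; exact: dirichlet_integrable.
Qed.

End Operators.

Section ZetaBound.
Context {R : realType} (nu : {finite_measure set (measurableTypeR R) -> \bar R}).
Local Notation D := (half_line R).
Local Notation alpha := (dirichlet_moment nu).

Definition dirichlet_coef (f : measurableTypeR R -> R) (n : nat) : R :=
  Rintegral nu D (fun s => n%:R `^ (- s) * f s).

(** The finite truncation of [J^* J]. *)
Lemma dirichlet_poly_coef f N t : square_integrable nu f ->
  dirichlet_poly (dirichlet_coef f) N t =
  Rintegral nu D (fun s => (\sum_(1 <= n < N) n%:R `^ (- (s + t))) * f s).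
Proof.
move=> f2; have int n : nu.-integrable D
    (EFin \o (fun s => n%:R `^ (- t) * (n%:R `^ (- s) * f s))).
  by have := integrableZl (@measurable_half_line R) (n%:R `^ (- t)) (dirichletM_integrable n f2).
transitivity (Rintegral nu D (fun s =>
    \sum_(1 <= n < N) n%:R `^ (- t) * (n%:R `^ (- s) * f s))).
  rewrite Rintegral_sum//; apply: eq_bigr => n _.
  by rewrite RintegralZl// 1?mulrC//; exact: dirichletM_integrable.
apply: eq_Rintegral => s _; rewrite mulr_suml big_nat [RHS]big_nat.
apply: eq_bigr => n /andP[n0 _].
by rewrite opprD powRD ?pnatr_eq0 ?gtn_eqF ?implybT//; ring.
Qed.

Lemma zetaM_integrable f t : square_integrable nu f -> D t ->
  nu.-integrable D (EFin \o (fun s => zeta (s + t) * f s)).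
Proof.
move=> f2 Dt; pose M := 1 + (t - 2^-1)^-1.
apply: (@le_integrable _ _ _ nu D _ _ (EFin \o (fun s => M * f s))) => //.
- apply/measurable_EFinP; apply: measurable_funM; last exact: f2.1.
  exact: measurable_zeta.
- move=> s Ds /=; have /andP[h0 h1] := zeta_half_le Ds Dt.
  rewrite lee_fin !normrM ler_wpM2r// !ger0_norm//; exact: le_trans h1.
- by have := integrableZl (@measurable_half_line R) M (square_integrable_integrable f2).
Qed.

(** For [s] in the half-line the partial sums of [zeta (s + t)] are bounded
    uniformly in [s], by [zeta_sum_half_le], so convergence is dominated. *)
Lemma dirichlet_poly_coef_cvg f t : square_integrable nu f -> D t ->
  dirichlet_poly (dirichlet_coef f) N t @[N --> \oo] -->
    Rintegral nu D (fun s => zeta (s + t) * f s).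
Proof.
move=> f2 Dt; have t2 : 0 < t - 2^-1 by move: Dt; rewrite half_lineE subr_gt0.
pose M := 1 + (t - 2^-1)^-1.
have M0 : 0 <= M by rewrite addr_ge0 ?invr_ge0 ?(ltW t2).
pose F N (s : measurableTypeR R) : \bar R :=
  ((\sum_(1 <= n < N) n%:R `^ (- (s + t))) * f s)%:E.
under eq_cvg do rewrite dirichlet_poly_coef//.
apply: (@fine_cvg _ _ _ _ (fun N => \int[nu]_(s in D) F N s)%E).
rewrite /Rintegral fineK; last first.
  by have := integrable_fin_num (@measurable_half_line R) (zetaM_integrable f2 Dt).
apply: (@dominated_cvg _ _ _ nu D _ F _ (fun s => (M * `|f s|)%:E)) => //.
- move=> N; apply/measurable_EFinP; apply: measurable_funM; last exact: f2.1.
  exact: measurable_zeta_sum.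
- move=> s Ds; apply: cvg_EFin; first by apply: nearW.
  apply: cvgM; last exact: cvg_cst.
  by apply: zeta_sum_cvg; exact: half_line_add.
- have := integrableZl (@measurable_half_line R) M
    (integrable_norm (square_integrable_integrable f2)).
  by [].
- move=> N s Ds; rewrite /F lee_fin normrM ler_wpM2r//.
  by have /andP[h0 h1] := zeta_sum_half_le N Ds Dt; rewrite ger0_norm.
Qed.

Lemma limn_einf_le (u : nat -> \bar R) (c : \bar R) :
  (forall n, u n <= c)%E -> (limn_einf u <= c)%E.
Proof.
move=> uc; rewrite limn_einf_lim; apply: lime_le; first exact: is_cvg_einfs.
apply: nearW => n; apply: le_trans (uc n); apply: ereal_inf_lbound.
by exists n => /=.
Qed.

(** Let [F N] be the truncation of [g], with coefficients [c n] and
    [S N = \sum_(n < N) c n ^ 2].  The matrix bound with constant [B = 4 * A]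
    gives [\int (F N) ^ 2 <= B * S N].  By definition of the coefficients [S N]
    is [\int F N * f], so Young's inequality with parameter [1 / B] gives
    [S N <= (S N + B * \int f ^ 2) / 2], that is [S N <= B * \int f ^ 2].  Both
    bounds together are uniform in [N]. *)
Lemma zeta_real_bounded (A : R) (f : measurableTypeR R -> R) : 0 < A ->
  (forall n, (0 < n)%N -> 0 <= alpha n <= A / (Num.sqrt n%:R * log1 R n)) ->
  square_integrable nu f ->
  let g t := Rintegral nu D (fun s => zeta (s + t) * f s) in
  measurable_fun D g /\
  (\int[nu]_(t in D) (g t ^+ 2)%:E <=
    ((4 * A) ^+ 2 * Rintegral nu D (fun s => f s ^+ 2))%:E)%E.
Proof.
move=> A0 hA f2 g; pose B := 4 * A; have B0 : 0 < B by rewrite mulr_gt0.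
pose I2 := Rintegral nu D (fun s => f s ^+ 2).
pose F := dirichlet_poly (dirichlet_coef f).
have Fg t : D t -> F N t @[N --> \oo] --> g t by exact: dirichlet_poly_coef_cvg.
split.
  apply: (@measurable_fun_cvg _ _ _ _ F g) => // N.
  exact: dirichlet_poly_measurable.
pose S N := \sum_(1 <= n < N) dirichlet_coef f n ^+ 2.
have F_le N : Rintegral nu D (fun s => F N s ^+ 2) <= B * S N.
  rewrite Rintegral_dirichlet_poly_sqr.
  apply: (le_trans (helson_schur _ _ _ (ltW A0) hA)).
  by rewrite /B /S; lra.
pose term n (s : measurableTypeR R) := dirichlet_coef f n * (n%:R `^ (- s) * f s).
have int_term n : nu.-integrable D (EFin \o term n).
  have h := dirichletM_integrable n f2.
  by have := integrableZl (@measurable_half_line R) (dirichlet_coef f n) h.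
have int N : nu.-integrable D (EFin \o (fun s => \sum_(1 <= n < N) term n s)).
  by apply: sum_integrable => n; exact: int_term.
have S_eq N : S N = Rintegral nu D (fun s => F N s * f s).
  transitivity (Rintegral nu D (fun s => \sum_(1 <= n < N) term n s)).
    rewrite Rintegral_sum//; apply: eq_bigr => n _.
    rewrite RintegralZl ?expr2//; exact: dirichletM_integrable.
  apply: eq_Rintegral => s _; rewrite mulr_suml; apply: eq_bigr => n _.
  by rewrite /term mulrA.
have S_le N : S N <= B * I2.
  have intF := dirichlet_poly_sqr_integrable nu (dirichlet_coef f) N.
  have int1 : nu.-integrable D (EFin \o (fun s => B^-1 * F N s ^+ 2)).
    by have := integrableZl (@measurable_half_line R) B^-1 intF.
  have int2 : nu.-integrable D (EFin \o (fun s => B * f s ^+ 2)).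
    by have := integrableZl (@measurable_half_line R) B f2.2.
  have int12 : nu.-integrable D (EFin \o (fun s => B^-1 * F N s ^+ 2 + B * f s ^+ 2)).
    by have := integrableD (@measurable_half_line R) int1 int2.
  have h : S N <= 2^-1 * (B^-1 * Rintegral nu D (fun s => F N s ^+ 2) + B * I2).
    rewrite S_eq -!RintegralZl//; last exact: f2.2.
    rewrite -RintegralD// -RintegralZl//; apply: le_Rintegral => //.
    - have := int N; apply: eq_integrable => // s _ /=; congr EFin.
      by rewrite mulr_suml; apply: eq_bigr => n _; rewrite /term mulrA.
    - by have := integrableZl (@measurable_half_line R) 2^-1 int12.
    - move=> s _; have := @young_mul R B^-1 (F N s) (f s); rewrite invrK invr_gt0.
      exact.
  have h2 : B^-1 * Rintegral nu D (fun s => F N s ^+ 2) <= S N.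
    by rewrite ler_pdivrMl.
  by lra.
apply: (@le_trans _ _ (\int[nu]_(t in D) limn_einf (fun N => (F N t ^+ 2)%:E))%E).
  rewrite le_eqVlt; apply/orP; left; apply/eqP; apply: eq_integral => t.
  rewrite inE => Dt; apply/esym/(cvg_limn_einf_sup _).1.
  apply: cvg_EFin; first by apply: nearW.
  by rewrite expr2; under eq_cvg do rewrite /= expr2; apply: cvgM; exact: Fg.
apply: (le_trans (fatou nu (@measurable_half_line R) _ _)).
- move=> N; apply/measurable_EFinP; apply: measurable_funX.
  exact: dirichlet_poly_measurable.
- by move=> N t _; rewrite lee_fin sqr_ge0.
apply: limn_einf_le => N.
have intF := dirichlet_poly_sqr_integrable nu (dirichlet_coef f) N.
rewrite -[X in (X <= _)%E]fineK; last exact: (integrable_fin_num _ intF).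
by rewrite lee_fin (le_trans (F_le N))// expr2 -mulrA ler_wpM2l ?(ltW B0)//.
Qed.

(** The kernel is real, so the operator acts separately on real and imaginary
    parts, and the squared norms add up. *)
Lemma zeta_bounded_of_decay (A : R) : 0 < A ->
  (forall n, (0 < n)%N -> 0 <= alpha n <= A / (Num.sqrt n%:R * log1 R n)) ->
  L2_bounded_operator nu (zeta_operator nu).
Proof.
move=> A0 hA; exists (4 * A) => f Lf; have [mRe mIm fin] := Lf.
have int2 := in_L2_integrable Lf.
have part (h : measurableTypeR R -> R) : measurable_fun D h ->
    (forall s, h s ^+ 2 <= modulus (f s) ^+ 2) -> square_integrable nu h.
  move=> mh hf; split=> //.
  apply: (@le_integrable _ _ _ nu D _ _ (EFin \o (fun s => modulus (f s) ^+ 2))) => //.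
    by apply/measurable_EFinP; exact: measurable_funX.
  by move=> s _; rewrite /= lee_fin !ger0_norm ?sqr_ge0.
have re2 : square_integrable nu (fun s => complex.Re (f s)).
  by apply: part => // s; rewrite sqr_modulus lerDl sqr_ge0.
have im2 : square_integrable nu (fun s => complex.Im (f s)).
  by apply: part => // s; rewrite sqr_modulus lerDr sqr_ge0.
have [mG1 G1] := zeta_real_bounded A0 hA re2.
have [mG2 G2] := zeta_real_bounded A0 hA im2.
have mTRe : measurable_fun D (fun t => complex.Re (zeta_operator nu f t)).
  by under eq_fun do rewrite Re_zeta_operator.
have mTIm : measurable_fun D (fun t => complex.Im (zeta_operator nu f t)).
  by under eq_fun do rewrite Im_zeta_operator.
have le2 : (\int[nu]_(t in D) (modulus (zeta_operator nu f t) ^+ 2)%:E <=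
    ((4 * A) ^+ 2 * Rintegral nu D (fun s => modulus (f s) ^+ 2))%:E)%E.
  under eq_integral do rewrite sqr_modulus Re_zeta_operator Im_zeta_operator EFinD.
  rewrite ge0_integralD//.
  - apply: (le_trans (leeD G1 G2)); rewrite -EFinD lee_fin -mulrDr.
    rewrite -RintegralD//; [|exact: re2.2|exact: im2.2].
    by under [X in _ <= _ * X]eq_Rintegral do rewrite sqr_modulus.
  - by move=> t _; rewrite lee_fin sqr_ge0.
  - by apply/measurable_EFinP; exact: measurable_funX.
  - by move=> t _; rewrite lee_fin sqr_ge0.
  - by apply/measurable_EFinP; exact: measurable_funX.
split; first by split=> //; apply: le_lt_trans le2 (ltry _).
rewrite -(ler_pXn2r (ltn0Sn 1)) ?nnegrE ?sqrtr_ge0 ?mulr_ge0 ?sqrtr_ge0 ?(ltW A0)//.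
rewrite exprMn !sqr_sqrtr ?Rintegral_ge0//; try by move=> s _; exact: sqr_ge0.
rewrite -lee_fin; apply: (le_trans _ le2); rewrite /Rintegral fineK//.
rewrite ge0_fin_numE; first exact: le_lt_trans le2 (ltry _).
by apply: integral_ge0 => t _; rewrite lee_fin sqr_ge0.
Qed.

End ZetaBound.

(** * The equivalence *)

Theorem theorem5p1 (R : realType)
    (nu : {finite_measure set (measurableTypeR R) -> \bar R})
    (nu_half_line : nu (~` half_line R) = 0%E) :
  let alpha := dirichlet_moment nu in
  [<-> l2_bounded_matrix (helson_matrix (fun n => (alpha n)%:C));
       exists2 C : R, 0 < C &
         \forall s \near (2^-1 : R)^'+,
           (nu `](2^-1)%R, s]%classic <= (C * (s - 2^-1))%:E)%E;
       exists2 C : R, 0 < C &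
         forall n : nat, (2 <= n)%N ->
           alpha n <= C / (Num.sqrt n%:R * ln n%:R);
       L2_bounded_operator nu (zeta_operator nu)].
Proof.
move=> alpha.
have decay c : 0 < c -> (forall e, 0 < e -> near_mass nu e <= c * e) ->
    exists2 A : R, 0 < A & forall n, (0 < n)%N ->
      0 <= alpha n <= A / (Num.sqrt n%:R * log1 R n).
  move=> c0 /(decay_of_linear_mass c0)[C C0 hC]; exact: decay_log1 C0 hC.
tfae.
- move=> /linear_mass_of_helson_bounded[c c0 hc].
  by exists c => //; exact: near_mass_linear.
- move=> [C C0 /(near_mass_linear_inv C0)[c c0 hc]].
  exact: decay_of_linear_mass hc.
- move=> [C C0 /(decay_log1 C0)[A A0 hA]]; exact: zeta_bounded_of_decay hA.
- move=> /linear_mass_of_zeta_bounded[c c0 /(decay c c0)[A A0 hA]].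
  exact: helson_bounded_of_decay (ltW A0) hA.
Qed.
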